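(* Let $(X,\|\cdot\|)$ be a real reflexive Banach space with dual $X^*$, let $N\in\mathbb{N}$, and let $A_1,\dots,A_N:X\to 2^{X^*}$ be maximally monotone operators such that $Z:=\bigcap_{i=1}^N A_i^{-1}(0)\ne\emptyset$. Let $f:X\to\mathbb{R}$ be bounded and uniformly Fréchet differentiable on each nonempty convex and bounded subset of $X$, and totally convex on bounded subsets of $X$, and suppose that the convex conjugate $f^*$ is bounded (hence finite) and uniformly Fréchet differentiable on bounded subsets of $X^*$. Let $x_0\in X$ be arbitrary. Then for arbitrary $\eta^i_n\in X^*$ and $\lambda^i_n>0$ ($i\in\{1,\dots,N\}$, $n=0,1,2,\dots$), there exist unique $w^i_n\in X$, $y^i_n\in X$, $\xi^i_n\in X^*$, $C^i_n\subseteq X$, $C_n\subseteq X$, $Q_n\subseteq X$ and $x_{n+1}\in X$ ($i\in\{1,\dots,N\}$, $n=0,1,2,\dots$) satisfying, for all such $i$ and $n$, the system $$\eta^i_n=\xi^i_n+\frac{1}{\lambda^i_n}\left(\nabla f(y^i_n)-\nabla f(x_n)\right),\quad \xi^i_n\in A_i(y^i_n),$$ $$w^i_n=\nabla f^*\left(\lambda^i_n\eta^i_n+\nabla f(x_n)\right),$$ $$C^i_n=\{z\in X: D_f(z,y^i_n)\le D_f(z,w^i_n)\},\qquad C_n=\bigcap_{i=1}^N C^i_n,$$ $$Q_n=\{z\in X:\langle\nabla f(x_0)-\nabla f(x_n),z-x_n\rangle\le 0\},$$ $$x_{n+1}=\mathrm{proj}^f_{C_n\cap Q_n}(x_0).$$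 Moreover, for all such $i$ and $n$, $$y^i_n=(\lambda^i_nA_i+\nabla f)^{-1}\left(\lambda^i_n\eta^i_n+\nabla f(x_n)\right),\qquad \xi^i_n=\eta^i_n-\frac{1}{\lambda^i_n}\left(\nabla f(y^i_n)-\nabla f(x_n)\right),$$ and $C_n\cap Q_n$ is convex, closed, and contains $Z$.
   Context: A set-valued operator $A:X\to 2^{X^*}$ is monotone if $\langle x_1^*-x_2^*,x_1-x_2\rangle\ge 0$ whenever $x_1^*\in Ax_1$, $x_2^*\in Ax_2$ (with $\langle x^*,x\rangle=x^*(x)$); it is maximally monotone if its graph is not properly contained in the graph of another monotone operator. For $B:X\to 2^{X^*}$, $B^{-1}(w)=\{x\in X:w\in Bx\}$; sums of sets are Minkowski sums (empty if one summand is empty), $(A+B)x=Ax+Bx$, $(\lambda A)(x)=\lambda A(x)$. The convex conjugate is $f^*(x^* )=\sup\{\langle x^*,x\rangle-f(x):x\in X\}$ for $x^*\in X^*$; $X^{**}$ is identified with $X$, so $\nabla f^*$ takes values in $X$. The Bregman distance is $D_f(y,x)=f(y)-f(x)-\langle\nabla f(x),y-x\rangle$, $x,y\in X$. Let $\nu_f(x,t)=\inf\{D_f(y,x):y\in X,\|y-x\|=t\}$. $f$ is totally convex on bounded subsets of $X$ if for each bounded $E\subset X$ one has $\inf\{\nu_f(x,t):x\in E\}>0$ for all $t>0$. Uniform Fréchet differentiability on a set $E$ means that the limit $\lim_{t\to0}(f(x+th)-f(x))/t=\langle\nabla f(x),h\rangle$ is attained uniformly over $x\in E$ and $\|h\|=1$.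 For a nonempty closed convex $C\subseteq X$ and $x\in X$, $\mathrm{proj}^f_C(x)$ (the Bregman projection) is the unique minimizer of $D_f(\cdot,x)$ over $C$; under the assumptions here it exists and is unique. Also, under the assumptions here, $(\lambda A_i+\nabla f)^{-1}(w)$ is a singleton for every $\lambda>0$ and $w\in X^*$, identified with its element. *)

(* Defs.v *)
From HB Require Import structures.
From mathcomp Require Import all_boot all_order all_algebra.
From mathcomp Require Import all_classical all_reals all_analysis.

Set Implicit Arguments.
Unset Strict Implicit.
Unset Printing Implicit Defensive.

Import Order.TTheory GRing.Theory Num.Theory.
Import numFieldNormedType.Exports.

Local Open Scope classical_set_scope.
Local Open Scope ring_scope.

Section DualSpace.
Context {R : realType}.

Definition linear_continuous_pred (X : normedModType R) : {pred X -> R^o} :=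
  mem [set g : X -> R^o | linear g /\ continuous g].

Lemma linear_continuous_submod (X : normedModType R) :
  submod_closed (@linear_continuous_pred X).
Proof.
split=> [|a g h]; rewrite ?inE /=.
  split=> [b u v|u]; first by rewrite /GRing.zero /= scaler0 addr0.
  exact: cst_continuous.
move=> [gl gc] [hl hc]; split=> [b u v|u].
  rewrite !fctE gl hl !scalerDr !scalerA [a * b]mulrC.
  by rewrite -!addrA; congr (_ + _); rewrite addrCA.
by apply: cvgD; [apply: cvgZr; exact: gc|exact: hc].
Qed.

HB.instance Definition _ (X : normedModType R) :=
  GRing.isSubmodClosed.Build R (X -> R^o) (@linear_continuous_pred X)
    (@linear_continuous_submod X).

Record dual (X : normedModType R) : Type := Dual {
  dual_fun :> X -> R^o ;
  dual_funP : dual_fun \in @linear_continuous_pred X }.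

HB.instance Definition _ (X : normedModType R) := [isSub for @dual_fun X].
HB.instance Definition _ (X : normedModType R) := [Choice of dual X by <:].
HB.instance Definition _ (X : normedModType R) :=
  [SubChoice_isSubLmodule of dual X by <:].

Lemma dual_linear (X : normedModType R) (g : dual X) : linear g.
Proof. by have := dual_funP g; rewrite inE => -[]. Qed.

Lemma dual_continuous (X : normedModType R) (g : dual X) : continuous g.
Proof. by have := dual_funP g; rewrite inE => -[]. Qed.

HB.instance Definition _ (X : normedModType R) (g : dual X) :=
  GRing.isLinear.Build R X R^o *:%R (dual_fun g) (@dual_linear X g).

Lemma dualP (X : normedModType R) (g h : dual X) : g =1 h -> g = h.
Proof. by move=> gh; apply/val_inj/funext. Qed.

Lemma dual_addE (X : normedModType R) (g h : dual X) x :
  (g + h) x = g x + h x.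
Proof. by []. Qed.

Lemma dual_scaleE (X : normedModType R) (a : R) (g : dual X) x :
  (a *: g) x = a * g x.
Proof. by []. Qed.

Definition dual_norm (X : normedModType R) (g : dual X) : R :=
  sup [set `|g x| | x in [set x : X | `|x| <= 1]].

Lemma dual_norm_has_sup (X : normedModType R) (g : dual X) :
  has_sup [set `|g x| | x in [set x : X | `|x| <= 1]].
Proof.
split; first by exists `|g 0|, 0 => //=; rewrite normr0 ler01.
have /linear_boundedP gb : bounded_near g (nbhs (0 : X)).
  by apply: continuous_linear_bounded; exact: dual_continuous.
have [M [Mr HM]] := gb; pose k := `|M| + 1.
have Mk : M < k by rewrite (le_lt_trans (ler_norm M)) // ltrDl ltr01.
exists k => _ [x /= x1 <-]; rewrite (le_trans (HM _ Mk x)) //.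
by rewrite ler_piMr // addr_ge0.
Qed.

Lemma dual_norm_ge0 (X : normedModType R) (g : dual X) : 0 <= dual_norm g.
Proof.
rewrite (le_trans (normr_ge0 (g 0))) //.
apply: ub_le_sup; first by case: (dual_norm_has_sup g).
by exists 0 => //=; rewrite normr0 ler01.
Qed.

Lemma dual_norm_le (X : normedModType R) (g : dual X) x :
  `|g x| <= dual_norm g * `|x|.
Proof.
have [->|x0] := eqVneq x 0; first by rewrite linear0 !normr0 mulr0.
have nx : 0 < `|x| by rewrite normr_gt0.
rewrite -ler_pdivrMr //.
have -> : `|g x| / `|x| = `|g (`|x|^-1 *: x)|.
  by rewrite linearZ /= normrZ normfV normr_id mulrC.
apply: ub_le_sup; first by case: (dual_norm_has_sup g).
by exists (`|x|^-1 *: x) => //=; rewrite normrZ normfV normr_id mulVf ?gt_eqF.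
Qed.

Lemma dual_norm_lub (X : normedModType R) (g : dual X) (M : R) :
  (forall x, `|x| <= 1 -> `|g x| <= M) -> dual_norm g <= M.
Proof.
move=> gM; apply: ge_sup; first by case: (dual_norm_has_sup g).
by move=> _ [x /= x1 <-]; exact: gM.
Qed.

Lemma dual_ler_normD (X : normedModType R) (g h : dual X) :
  dual_norm (g + h) <= dual_norm g + dual_norm h.
Proof.
apply: dual_norm_lub => x x1; rewrite dual_addE (le_trans (ler_normD _ _)) //.
by rewrite lerD // (le_trans (dual_norm_le _ _)) // ler_piMr // dual_norm_ge0.
Qed.

Lemma dual_normZ_le (X : normedModType R) (a : R) (g : dual X) :
  dual_norm (a *: g) <= `|a| * dual_norm g.
Proof.
apply: dual_norm_lub => x x1; rewrite dual_scaleE normrM ler_wpM2l //.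
by rewrite (le_trans (dual_norm_le _ _)) // ler_piMr // dual_norm_ge0.
Qed.

Lemma dual_normZ (X : normedModType R) (a : R) (g : dual X) :
  dual_norm (a *: g) = `|a| * dual_norm g.
Proof.
apply/eqP; rewrite eq_le dual_normZ_le /=.
have [->|a0] := eqVneq a 0; first by rewrite normr0 mul0r dual_norm_ge0.
rewrite -ler_pdivlMl ?normr_gt0 // -normfV.
by rewrite -[in leLHS](scalerK a0 g) dual_normZ_le.
Qed.

Lemma dual_norm0_eq0 (X : normedModType R) (g : dual X) :
  dual_norm g = 0 -> g = 0.
Proof.
move=> g0; apply: dualP => x; apply/normr0_eq0/eqP.
by rewrite eq_le normr_ge0 andbT (le_trans (dual_norm_le _ _)) // g0 mul0r.
Qed.

HB.instance Definition _ (X : normedModType R) :=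
  Lmodule_isNormed.Build R (dual X)
    (@dual_ler_normD X) (@dual_normZ X) (@dual_norm0_eq0 X).

Lemma dual_normE (X : normedModType R) (g : dual X) : `|g| = dual_norm g.
Proof. by []. Qed.

Lemma bidual_eval_subproof (X : normedModType R) (x : X) :
  (fun g : dual X => g x : R^o) \in @linear_continuous_pred (dual X).
Proof.
rewrite inE; have evl : linear (fun g : dual X => g x : R^o) by [].
split=> //.
pose ev : {linear dual X -> R^o} :=
  HB.pack (fun g : dual X => g x : R^o) (GRing.isLinear.Build _ _ _ _ _ evl).
apply: (@bounded_linear_continuous _ _ _ ev); apply/linear_boundedP.
exists `|x|; split=> [|r xr g]; first exact: normr_real.
by apply: (le_trans (dual_norm_le g x)); rewrite mulrC ler_wpM2r ?dual_norm_ge0 ?ltW.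
Qed.

Definition bidual_eval (X : normedModType R) (x : X) : dual (dual X) :=
  Dual (bidual_eval_subproof x).

Definition reflexive_space (X : normedModType R) :=
  forall phi : dual (dual X), exists x : X, bidual_eval x = phi.

(* The inverse of the canonical embedding of X into its bidual, which realizes
   the identification of the two spaces when X is reflexive. *)
Definition of_bidual (X : normedModType R) (phi : dual (dual X)) : X :=
  xget 0 [set x | bidual_eval x = phi].

End DualSpace.

Section MonotoneOperators.
Context {R : realType} {X : normedModType R}.
Implicit Types A B : X -> set (dual X).

Definition op_graph A : set (X * dual X) := [set p | A p.1 p.2].

Definition monotone_op A := forall (x1 x2 : X) (g1 g2 : dual X),
  A x1 g1 -> A x2 g2 -> 0 <= (g1 - g2) (x1 - x2).

Definition maximally_monotone A :=
  monotone_op A /\ ~ exists B, monotone_op B /\ op_graph A `<` op_graph B.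

Definition op_inv A (g : dual X) : set X := [set x | A x g].

Definition common_zeros (N : nat) (A : 'I_N -> X -> set (dual X)) : set X :=
  \bigcap_(i in [set: 'I_N]) op_inv (A i) 0.

Definition op_add A B (x : X) : set (dual X) :=
  [set a + b | a in A x & b in B x].

Definition op_scale (l : R) A (x : X) : set (dual X) :=
  [set l *: a | a in A x].

Definition op_of_fun (F : X -> dual X) (x : X) : set (dual X) := [set F x].

End MonotoneOperators.

Section Differentiability.
Context {R : realType} {X : normedModType R}.
Implicit Types (f : X -> R^o) (E : set X).

(* The Frechet derivative as an element of the dual space. *)
Definition grad f (x : X) : dual X := xget 0 [set g : dual X | is_diff x f g].

Definition uniformly_frechet_on f E :=
  (forall x, E x -> differentiable f x) /\
  forall e : R, 0 < e -> \forall t \near (0 : R)^',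
    forall x h : X, E x -> `|h| = 1 ->
      `|t^-1 * (f (x + t *: h) - f x) - grad f x h| < e.

Definition conjugate f (g : dual X) : \bar R :=
  ereal_sup [set (g x - f x)%:E | x in [set: X]].

(* Real-valued version of the conjugate, meaningful where the latter is
   finite. *)
Definition conjugate_fun f (g : dual X) : R^o := fine (conjugate f g).

Definition bregman_dist f (y x : X) : R := f y - f x - grad f x (y - x).

(* The infima below are taken in the extended reals, so that the infimum of
   the empty set is +oo. *)
Definition bregman_modulus f (x : X) (t : R) : \bar R :=
  ereal_inf [set (bregman_dist f y x)%:E | y in [set y : X | `|y - x| = t]].

Definition totally_convex_on_bounded f :=
  forall E, bounded_set E -> forall t : R, 0 < t ->
    (0 < ereal_inf [set bregman_modulus f x t | x in E])%E.

(* p is the unique minimizer of the Bregman distance to x over C. *)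
Definition is_bregman_proj f (C : set X) (x p : X) :=
  [set q | C q /\ forall z, C z -> bregman_dist f q x <= bregman_dist f z x]
  = [set p].

End Differentiability.

Definition grad_conjugate {R : realType} {X : normedModType R} (f : X -> R^o)
    (g : dual X) : X :=
  of_bidual (grad (conjugate_fun f) g).

Record iterates (R : realType) (X : normedModType R) (N : nat) := Iterates {
  it_w : nat -> 'I_N -> X ;
  it_y : nat -> 'I_N -> X ;
  it_xi : nat -> 'I_N -> dual X ;
  it_Ci : nat -> 'I_N -> set X ;
  it_C : nat -> set X ;
  it_Q : nat -> set X ;
  it_x : nat -> X }.

Record bregman_system (R : realType) (X : normedModType R) (N : nat)
    (A : 'I_N -> X -> set (dual X)) (f : X -> R^o) (x0 : X)
    (eta : nat -> 'I_N -> dual X) (lambda : nat -> 'I_N -> R)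
    (s : iterates X N) : Prop := BregmanSystem {
  sys_x0 : it_x s 0 = x0 ;
  sys_eta : forall n i, eta n i = it_xi s n i +
    (1 / lambda n i) *: (grad f (it_y s n i) - grad f (it_x s n)) ;
  sys_xi : forall n i, A i (it_y s n i) (it_xi s n i) ;
  sys_w : forall n i, it_w s n i =
    grad_conjugate f (lambda n i *: eta n i + grad f (it_x s n)) ;
  sys_Ci : forall n i, it_Ci s n i =
    [set z | bregman_dist f z (it_y s n i) <= bregman_dist f z (it_w s n i)] ;
  sys_C : forall n, it_C s n = \bigcap_(i in [set: 'I_N]) it_Ci s n i ;
  sys_Q : forall n, it_Q s n =
    [set z | (grad f x0 - grad f (it_x s n)) (z - it_x s n) <= 0] ;
  sys_proj : forall n,
    is_bregman_proj f (it_C s n `&` it_Q s n) x0 (it_x s n.+1) }.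

(* Main.v *)
(* Total convexity makes D_f(y, x) > 0 for y <> x, so f is strictly convex.

   Resolvents.  For B maximally monotone, the set of (x, g, r) with r at least
   the Fitzpatrick function of B at (x, g) is convex and satisfies r >= g x,
   while g x + f x + f^*(- g) >= 0 by Fenchel-Young.  A Hahn-Banach argument
   puts an affine function between the two; it is bounded, hence by reflexivity
   given by some (p, z).  Maximality of B yields p \in B z, and equality in
   Fenchel-Young yields p = - grad f z.  With B := l A - w this solves
   w \in l A z + grad f z; uniqueness is strict monotonicity of grad f.

   Projections.  Total convexity on bounded sets makes minimizing sequences of
   D_f(-, x) over a closed convex set Cauchy (compare two almost minimizers with
   their midpoint), so they converge without any weak compactness.

   The sets C_n^i are half-spaces, and each contains Z since
   D_f(z, w) - D_f(z, y) = D_f(y, w) + l <xi, y - z> when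
   grad f w = l xi + grad f y.  The variational inequality of x_{n+1} puts Z in
   Q_{n+1}. *)
From HB Require Import structures.
Require Import Defs.
From mathcomp Require Import all_boot all_order all_algebra.
From mathcomp Require Import ring lra.
From mathcomp Require Import all_classical all_reals all_analysis.

Set Implicit Arguments.
Unset Strict Implicit.
Unset Printing Implicit Defensive.

Import Order.TTheory GRing.Theory Num.Theory.
Import numFieldNormedType.Exports.

Local Open Scope classical_set_scope.
Local Open Scope ring_scope.

(** * Hahn-Banach: linear minorants of cones and convex separation *)

(** Plays the part of the epigraph of a sublinear functional; the last two conditions make its lower
    envelope finite. *)
Definition dominating_cone (R : realType) (V : lmodType R) (K : set (V * R)) :=
  [/\ forall u r v s, K (u, r) -> K (v, s) -> K (u + v, r + s),
      forall t u r, 0 < t -> K (u, r) -> K (t *: u, t * r),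
      forall u, exists r, K (u, r) &
      forall r, K (0, r) -> 0 <= r].

Lemma maximal_dominating_cone (R : realType) (V : lmodType R)
    (K0 : set (V * R)) : dominating_cone K0 ->
  exists K, [/\ K0 `<=` K, dominating_cone K &
    forall K', dominating_cone K' -> K `<=` K' -> K' `<=` K].
Proof.
move=> K0cone.
(* Zorn is applied to the sets whose union with [K0] is such a cone, so that the empty chain, with
   empty union, is covered by [K0] itself. *)
have [F FP Ftot|K [Kcone Kmax]] :=
  @Zorn_bigcup _ [set K : set (V * R) | dominating_cone (K `|` K0)].
  have [Hadd Hscale Htot H0] := K0cone; split.
  - move=> u r v s [[K FK Ku]|Ku] [[K' FK' K'v]|Kv].
    + have [KK'|K'K] := Ftot _ _ FK FK'.
        have [+ _ _ _] := FP _ FK'.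
        by move=> /(_ u r v s (or_introl (KK' _ Ku)) (or_introl K'v))
          [?|?]; [left; exists K'|right].
      have [+ _ _ _] := FP _ FK.
      by move=> /(_ u r v s (or_introl Ku) (or_introl (K'K _ K'v)))
          [?|?]; [left; exists K|right].
    + have [+ _ _ _] := FP _ FK.
      by move=> /(_ u r v s (or_introl Ku) (or_intror Kv))
          [?|?]; [left; exists K|right].
    + have [+ _ _ _] := FP _ FK'.
      by move=> /(_ u r v s (or_intror Ku) (or_introl K'v))
          [?|?]; [left; exists K'|right].
    + by right; exact: Hadd.
  - move=> t u r t0 [[K FK Ku]|Ku]; last by right; exact: Hscale.
    have [_ + _ _] := FP _ FK.
    by move=> /(_ t u r t0 (or_introl Ku)) [?|?]; [left; exists K|right].
  - by move=> u; have [r Kr] := Htot u; exists r; right.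
  - move=> r [[K FK Kr]|]; last exact: H0.
    by have [_ _ _] := FP _ FK; apply; left.
exists (K `|` K0); split; [by move=> p ?;
  right|exact: Kcone|move=> K' K'cone KK'].
apply: contrapT => K'K; apply: (Kmax K').
  split; first by move=> p ?; apply: KK'; left.
  by apply: contra_not K'K => K'K p /K'K; left.
by rewrite /= setUidl // => p ?; apply: KK'; right.
Qed.

(* The lower envelope of a maximal cone is additive: adding the ray through
   (- v, - L v) to such a cone does not enlarge it. *)
Lemma dominating_cone_minorant (R : realType) (V : lmodType R)
    (K0 : set (V * R)) : dominating_cone K0 ->
  exists L : V -> R^o, linear L /\ forall u r, K0 (u, r) -> L u <= r.
Proof.
move=> /maximal_dominating_cone[K [K0K [Kadd Kscale Ktot Knneg] Kmax]].
pose S v := [set r | K (v, r)].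
pose L v := inf (S v) : R^o.
have Sinf v : has_inf (S v).
  split; first exact: Ktot.
  have [s Ks] := Ktot (- v); exists (- s) => r Kr.
  rewrite -subr_ge0 opprK; apply: Knneg; rewrite -(subrr v); exact: Kadd.
have LK v r : K (v, r) -> L v <= r by move=> Kvr; apply: ge_inf => //;
  apply: (Sinf v).2.
have KL v m : (forall r, K (v, r) -> m <= r) -> m <= L v.
  by move=> mK; apply: lb_le_inf => //; exact: (Sinf v).1.
have LD u v : L (u + v) <= L u + L v.
  rewrite -lerBlDr; apply: (KL) => r Kr; rewrite lerBlDr -lerBlDl.
  apply: KL => s Ks; rewrite lerBlDl; apply: LK.
  exact: Kadd.
have LZle t u : 0 < t -> L (t *: u) <= t * L u.
  move=> t0; rewrite mulrC -ler_pdivrMr //; apply: KL => r Kr.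
  by rewrite ler_pdivrMr // mulrC; apply/LK/Kscale.
have LZ t u : 0 < t -> L (t *: u) = t * L u.
  move=> t0; apply/eqP; rewrite eq_le LZle //= -ler_pdivlMl //.
  have := @LZle t^-1 (t *: u); rewrite scalerA mulVf ?gt_eqF // scale1r.
  by apply; rewrite invr_gt0.
have L0 : L 0 = 0.
  have : L 0 = 2 * L 0 by rewrite -LZ // scaler0.
  by lra.
have Lsub x v : L (x - v) <= L x - L v.
  rewrite lerBrDr; apply: KL => r Kr; rewrite -lerBrDr.
  pose K' := [set p : V * R | exists t y s,
    [/\ 0 <= t, K (y, s), p.1 = y - t *: v & p.2 = s - t * L v]].
  have K'cone : dominating_cone K'.
    split.
    - move=> u a v' b [t [y [s [/= t0 Ky -> ->]]]] [t' [y' [s' [/= t'0 Ky' ->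
      ->]]]].
      exists (t + t'), (y + y'), (s + s'); split=> /=;
        [exact: addr_ge0|exact: Kadd| |].
        by rewrite scalerDl opprD addrACA.
      by rewrite mulrDl opprD addrACA.
    - move=> c u a c0 [t [y [s [/= t0 Ky -> ->]]]].
      exists (c * t), (c *: y), (c * s); split=> /=;
        [by rewrite mulr_ge0 // ltW|exact: Kscale| |].
        by rewrite scalerBr scalerA.
      by rewrite mulrBr mulrA.
    - move=> u; have [s Ks] := Ktot u; exists s, 0, u, s.
      by rewrite /= scale0r mul0r !subr0.
    - move=> a [t [y [s [/= t0 Ky /esym/eqP]]]];
      rewrite subr_eq0 => /eqP ytv ->.
      move: t0; rewrite le_eqVlt => /predU1P[t0|t0].
        rewrite -t0 mul0r subr0; apply: Knneg.
        by rewrite ytv -t0 scale0r in Ky.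
      rewrite subr_ge0 -LZ // -ytv; exact: LK.
  (* The point [(x - v, r - L v)] lies in [K'] with [t = 1], hence in [K] by maximality. *)
  apply: LK; apply: (Kmax K' K'cone); last by exists 1, x, r;
    rewrite /= scale1r mul1r.
  by move=> [y s] Ks; exists 0, y, s; rewrite /= scale0r mul0r !subr0.
exists L; split; last by move=> u r /K0K/LK.
have LN v : L (- v) = - L v.
  apply/eqP; rewrite eq_le; have := Lsub 0 v; rewrite add0r L0 add0r => -> /=.
  by have := LD v (- v); rewrite subrr L0; lra.
have LB x v : L (x - v) = L x - L v.
  by apply/eqP; rewrite eq_le Lsub lerBlDr; have := LD (x - v) v; rewrite subrK.
have LZ' t u : L (t *: u) = t * L u.
  have [t0|t0|<-] := ltgtP 0 t; first exact: LZ.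
    by rewrite -[t]opprK scaleNr LN LZ ?oppr_gt0 // !mulNr !opprK.
  by rewrite scale0r L0 mul0r.
by move=> t u v; rewrite -[v in LHS]opprK LB LN opprK LZ'.
Qed.

(** The points [(u - v, r + h v)] with [(u, r)] in [C] generate a cone. Over 0 one has [u = v], so
    its heights there are nonnegative; a linear minorant of this cone is the separating
    functional. *)
Lemma convex_separation (R : realType) (V : lmodType R) (C : set (V * R))
    (h : V -> R) :
  C !=set0 ->
  (forall t u v r s, 0 <= t <= 1 -> C (u, r) -> C (v, s) ->
    C (t *: u + (1 - t) *: v, t * r + (1 - t) * s)) ->
  (forall t u v, 0 <= t <= 1 ->
    h (t *: u + (1 - t) *: v) <= t * h u + (1 - t) * h v) ->
  (forall u r, C (u, r) -> 0 <= r + h u) ->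
  exists L : V -> R^o, linear L /\
    forall u r v, C (u, r) -> L u - L v <= r + h v.
Proof.
move=> [[u0 r0] C0] Cconv hconv Ch.
pose K : set (V * R) := [set p | exists t u r v,
  [/\ 0 < t, C (u, r), p.1 = t *: (u - v) & t * (r + h v) <= p.2]].
have [|L [Llin LK]] := @dominating_cone_minorant R V K.
  split.
  - move=> _ a _ b [t [u [r [v [/= t0 Cu -> ta]]]]] [t' [u' [r' [v' [/= t'0 Cu'
    -> tb]]]]].
    have tt0 : 0 < t + t' by exact: addr_gt0.
    (* The weight [c = t / (t + t')] turns the sum of two scaled points into one scaled convex
       combination. *)
    have [c [c01 tc tc']] : exists c,
        [/\ 0 <= c <= 1, (t + t') * c = t & (t + t') * (1 - c) = t'].
      have tc : (t + t') * (t / (t + t')) = t by rewrite mulrC divfK // gt_eqF.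
      exists (t / (t + t')); split=> //; last first.
        by rewrite mulrBr mulr1 tc addrAC subrr add0r.
      apply/andP; split; first by rewrite divr_ge0 ?(ltW t0) ?ltW.
      by rewrite ler_pdivrMr // mul1r lerDl ltW.
    exists (t + t'), (c *: u + (1 - c) *: u'), (c * r + (1 - c) * r'),
      (c *: v + (1 - c) *: v'); split => //=.
    + exact: Cconv.
    + by rewrite opprD addrACA -!scalerBr [RHS]scalerDr !scalerA tc tc'.
    + apply: le_trans (lerD ta tb).
      apply: (@le_trans _ _ ((t + t') * (c * (r + h v) + (1 - c) * (r' + h
        v')))).
        by rewrite ler_pM2l //; have := hconv _ v v' c01; lra.
      by rewrite [leLHS]mulrDr !mulrA tc tc'.
  - move=> c _ a c0 [t [u [r [v [/= t0 Cu -> ta]]]]].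
    exists (c * t), u, r, v; split => //=; first exact: mulr_gt0.
      by rewrite scalerA.
    by rewrite -mulrA ler_pM2l.
  (* Taking [v = u0 - u] gives [u0 - v = u], so a single point of [C] reaches every [u]. *)
  - move=> u; exists (r0 + h (u0 - u)), 1, u0, r0, (u0 - u).
    by rewrite /= scale1r mul1r opprB addrC subrK.
  - move=> a [t [u [r [v [/= t0 Cu /esym/eqP]]]]].
    rewrite scaler_eq0 gt_eqF //= subr_eq0 => /eqP <-; apply: le_trans.
    by apply: mulr_ge0; [exact: ltW|exact: Ch].
exists L; split=> // u r v Cur.
have -> : L u - L v = L (u - v).
  by have := Llin (- 1) v u; rewrite !scaleN1r [- v + u]addrC => ->;
    rewrite addrC.
by apply: LK; exists 1, u, r, v; rewrite /= scale1r mul1r.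
Qed.

(** * Gradients, subgradients and continuous linear forms *)

Section Gradient.
Context {R : realType} {X : normedModType R}.
Implicit Types (f : X -> R^o) (g : dual X).

Lemma dual_funZ g (t : R) x : g (t *: x) = t * g x.
Proof. exact: linearZ. Qed.

(** The differential itself is a witness, so [xget] does not fall back on its default. *)
Lemma grad_is_diff f x : differentiable f x -> is_diff x f (grad f x).
Proof.
move=> fx.
have dP : ('d f x : X -> R^o) \in @linear_continuous_pred R X.
  by rewrite inE; split=> [a u v|]; [rewrite linearP|exact: diff_continuous].
suff : exists g : dual X, is_diff x f g by exact: xgetPex.
by exists (Dual dP); split.
Qed.

Lemma grad_at_right f x h : differentiable f x ->
  (fun t => t^-1 * (f (t *: h + x) - f x)) t @[t --> 0^'+] --> grad f x h.
Proof.
move=> fx; apply: cvg_dnbhs_at_right.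
have [_ <-] := grad_is_diff fx; rewrite -deriveE //.
by have /(_ h)/derivableP[] := diff_derivable fx.
Qed.

Lemma le_grad f x h (c : R) : differentiable f x ->
  (forall t, 0 < t <= 1 -> t * c <= f (t *: h + x) - f x) -> c <= grad f x h.
Proof.
move=> fx cf; apply: (cvgr_to_ge (grad_at_right (h := h) fx)).
near=> t.
have t0 : 0 < t by near: t; exact: nbhs_right_gt.
by rewrite ler_pdivlMl // cf // t0; near: t; exact: nbhs_right_le.
Unshelve. all: by end_near. Qed.

Lemma grad_le f x h (c : R) : differentiable f x ->
  (forall t, 0 < t <= 1 -> f (t *: h + x) - f x <= t * c) -> grad f x h <= c.
Proof.
move=> fx cf; apply: (cvgr_to_le (grad_at_right (h := h) fx)).
near=> t.
have t0 : 0 < t by near: t; exact: nbhs_right_gt.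
by rewrite ler_pdivrMl // cf // t0; near: t; exact: nbhs_right_le.
Unshelve. all: by end_near. Qed.

(** Difference quotients bound [g h] by [grad f x h] in each direction; the direction [- h] gives
    the converse. *)
Lemma subgradient_grad f x g : differentiable f x ->
  (forall y, f x + g (y - x) <= f y) -> grad f x = g.
Proof.
move=> fx gf; apply: dualP.
have gle h : g h <= grad f x h.
  apply: le_grad => // t _; rewrite lerBrDl.
  by have := gf (t *: h + x); rewrite addrK linearZ.
move=> h; apply/eqP; rewrite eq_le gle andbT.
by have := gle (- h); rewrite !linearN lerN2.
Qed.

End Gradient.

(** The unit ball is symmetric, so the upper bound also bounds the absolute value of [l], whence
    continuity. *)
Lemma bounded_above_linear_dual (R : realType) (X : normedModType R)
    (l : X -> R^o) (M : R) :
  linear l -> (forall x, `|x| <= 1 -> l x <= M) -> exists g : dual X, g =1 l.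
Proof.
move=> ll lM.
pose k : {linear X -> R^o} := HB.pack l (GRing.isLinear.Build _ _ _ _ _ ll).
have kM x : k x <= M * `|x|.
  have [->|x0] := eqVneq x 0; first by rewrite linear0 normr0 mulr0.
  have nx : 0 < `|x| by rewrite normr_gt0.
  rewrite -ler_pdivrMr //.
  have -> : k x / `|x| = k (`|x|^-1 *: x) by rewrite linearZ /= mulrC.
  by apply: lM; rewrite normrZ normfV normr_id mulVf ?gt_eqF.
have kc : continuous k.
  apply: bounded_linear_continuous; apply/linear_boundedP.
  exists M; split=> [|r Mr x]; first exact: num_real.
  rewrite ler_norml; apply/andP; split; last first.
    by apply: le_trans (kM x) _; rewrite ler_wpM2r // ltW.
  rewrite lerNl -linearN; apply: le_trans (kM _) _.
  by rewrite normrN ler_wpM2r // ltW.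
have lP : l \in @linear_continuous_pred R X by rewrite inE; split.
by exists (Dual lP).
Qed.

(** * Total convexity and Bregman distances *)

Section TotalConvexity.
Context {R : realType} {X : normedModType R}.
Implicit Types (f : X -> R^o).

Lemma totally_convex_lower_bound f (E : set X) (t : R) :
  totally_convex_on_bounded f -> bounded_set E -> 0 < t ->
  exists2 d : R, 0 < d &
    forall x y, E x -> `|y - x| = t -> d <= bregman_dist f y x.
Proof.
move=> ftc Eb t0; have := ftc E Eb t t0.
set m := ereal_inf _ => m0.
have mle x y : E x -> `|y - x| = t -> (m <= (bregman_dist f y x)%:E)%E.
  move=> Ex yxt; apply: (@le_trans _ _ (bregman_modulus f x t)).
    by apply: ereal_inf_lbound; exists x.
  by apply: ereal_inf_lbound; exists y.
case: m m0 mle => [d| |] // d0 dle.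
  by exists d => // x y Ex /(dle _ _ Ex).
(* An infimum equal to [+oo] means that no such pair exists, so any positive bound will do. *)
by exists 1 => // x y Ex /(dle _ _ Ex).
Qed.

Lemma totally_convex_bregman_gt0 f : totally_convex_on_bounded f ->
  forall x y, y != x -> 0 < bregman_dist f y x.
Proof.
move=> ftc x y yx; have xb : bounded_set [set x].
  by exists `|x|; split=> [|M /ltW xM _ /= ->]; first exact: num_real.
have [|d d0 dle] := totally_convex_lower_bound (t := `|y - x|) ftc xb.
  by rewrite normr_gt0 subr_eq0.
exact: lt_le_trans d0 (dle _ _ _ _).
Qed.

End TotalConvexity.

Section Bregman.
Context {R : realType} {X : normedModType R} (f : X -> R^o)
  (bregman_gt0 : forall x y, y != x -> 0 < bregman_dist f y x).

Lemma bregman_dist_refl x : bregman_dist f x x = 0.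
Proof. by rewrite /bregman_dist !subrr linear0 subr0. Qed.

Lemma bregman_ge0 x y : 0 <= bregman_dist f y x.
Proof.
by have [->|/bregman_gt0/ltW//] := eqVneq y x; rewrite bregman_dist_refl.
Qed.

(** The pairing equals [bregman_dist f x y + bregman_dist f y x]. *)
Lemma grad_strictly_monotone x y : x != y ->
  0 < (grad f x - grad f y) (x - y).
Proof.
move=> xy; have := addr_gt0 (bregman_gt0 xy).
rewrite eq_sym in xy; move=> /(_ _ (bregman_gt0 xy)).
rewrite /bregman_dist -[y - x]opprB linearN.
by have -> : (grad f x - grad f y) (x - y) = grad f x (x - y) - grad f y (x -
  y);
  [|lra].
Qed.

(** The gradient terms at [m] cancel because [t *: (x - m) + (1 - t) *: (y - m) = 0]. This writes
    the Jensen gap of [f] exactly. *)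
Lemma bregman_combination t x y : let m := t *: x + (1 - t) *: y in
  t * f x + (1 - t) * f y =
  f m + t * bregman_dist f x m + (1 - t) * bregman_dist f y m.
Proof.
move=> m; rewrite /bregman_dist.
have : t * grad f m (x - m) + (1 - t) * grad f m (y - m) = 0.
  have -> : t * grad f m (x - m) + (1 - t) * grad f m (y - m) =
      grad f m (t *: (x - m) + (1 - t) *: (y - m)).
    by rewrite [RHS]linearD !linearZ.
  rewrite !scalerBr addrACA -/m -opprD -scalerDl [t + _]addrC subrK scale1r
    subrr.
  by rewrite linear0.
by lra.
Qed.

Lemma bregman_convex t x y : 0 <= t <= 1 ->
  f (t *: x + (1 - t) *: y) <= t * f x + (1 - t) * f y.
Proof.
move=> /andP[t0 t1]; rewrite bregman_combination -addrA lerDl.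
by rewrite addr_ge0 // mulr_ge0 ?bregman_ge0 ?subr_ge0.
Qed.

End Bregman.

Lemma segmentE (R : pzRingType) (V : lmodType R) (t : R) (x y : V) :
  t *: (x - y) + y = t *: x + (1 - t) *: y.
Proof. by rewrite scalerBr scalerBl scale1r -addrA [- _ + y]addrC. Qed.

(** * Conjugates, and the surjectivity behind resolvents *)

Section Conjugate.
Context {R : realType} {X : normedModType R} (f : X -> R^o)
  (bregman_gt0 : forall x y, y != x -> 0 < bregman_dist f y x)
  (fstar_fin : forall g, conjugate f g \is a fin_num).
Implicit Types (g : dual X).
Local Notation fstar := (conjugate_fun f).

Lemma fenchel_young x g : g x - f x <= fstar g.
Proof.
by rewrite -lee_fin fineK //; apply: ereal_sup_ubound; exists x.
Qed.

Lemma conjugate_le g (M : R) : (forall x, g x - f x <= M) -> fstar g <= M.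
Proof.
move=> gM; rewrite -lee_fin fineK //; apply: ge_ereal_sup => _ [x _ <-].
by rewrite lee_fin.
Qed.

Lemma conjugate_convex (t : R) g h : 0 <= t <= 1 ->
  fstar (t *: g + (1 - t) *: h) <= t * fstar g + (1 - t) * fstar h.
Proof.
move=> /andP[t0 t1]; apply: conjugate_le => x.
rewrite dual_addE !dual_scaleE.
have -> : t * g x + (1 - t) * h x - f x =
  t * (g x - f x) + (1 - t) * (h x - f x) by ring.
by rewrite lerD // ler_wpM2l ?subr_ge0 // fenchel_young.
Qed.

(** This is the nonnegativity of [bregman_dist f y x] for all [y]; together with [fenchel_young] it
    is an equality. *)
Lemma conjugate_grad_le x : fstar (grad f x) <= grad f x x - f x.
Proof.
apply: conjugate_le => y; have := bregman_ge0 bregman_gt0 x y.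
by rewrite /bregman_dist linearB /=; lra.
Qed.

(** Equality in Fenchel-Young makes [g] a subgradient of [f] at [x]. *)
Lemma fenchel_eq_grad x g : differentiable f x ->
  fstar g + f x <= g x -> grad f x = g.
Proof.
move=> fx gx; apply: subgradient_grad => // y; rewrite linearB /=.
by have := fenchel_young y g; lra.
Qed.

Lemma conjugate_grad_subgradient g h : differentiable fstar g ->
  grad fstar g (h - g) <= fstar h - fstar g.
Proof.
move=> gdiff; apply: grad_le => // t /andP[t0 t1].
have -> : t *: (h - g) + g = t *: h + (1 - t) *: g.
  by rewrite scalerBr scalerBl scale1r -addrA [- _ + g]addrC.
have := @conjugate_convex t h g; rewrite ltW // t1 => /(_ isT).
by lra.
Qed.

(** The subgradient inequality of [fstar] at [g], tested at [grad f w] where [fstar] is known, gives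
    equality in Fenchel-Young for [w] and [g]. *)
Lemma grad_grad_conjugate g : reflexive_space X ->
  (forall x, differentiable f x) -> differentiable fstar g ->
  grad f (grad_conjugate f g) = g.
Proof.
move=> refl fdiff gdiff; set w := grad_conjugate f g.
have wE : bidual_eval w = grad fstar g.
  by apply: (@xgetPex _ 0 [set x | bidual_eval x = grad fstar g]); exact: refl.
apply: fenchel_eq_grad => //.
have := conjugate_grad_subgradient (grad f w) gdiff.
have -> : grad fstar g (grad f w - g) = grad f w w - g w by rewrite -wE.
by have := conjugate_grad_le w; lra.
Qed.

(* The epigraph of the Fitzpatrick function of [B] is separated from the
   hypograph of [(v, g) |-> - f v - f^* (- g)]; by reflexivity the separating
   functional is a pair [(p, z)], and it is a point of the graph of [B]. *)
Lemma maximal_monotone_grad_surjective (B : X -> set (dual X)) :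
  reflexive_space X -> (forall x, differentiable f x) ->
  (exists M, forall x, `|x| <= 1 -> f x <= M) ->
  (exists M, forall g : dual X, `|g| <= 1 -> fstar g <= M) ->
  (exists x g, B x g) -> monotone_op B ->
  (forall z p, (forall x g, B x g -> 0 <= (g - p) (x - z)) -> B z p) ->
  exists z, B z (- grad f z).
Proof.
move=> refl fdiff [Mf fM] [Ms sM] [x0 [g0 Bx0]] Bmono Bmax.
pose C : set (X * dual X * R) := [set q : X * dual X * R | forall x g, B x g ->
  g q.1.1 + q.1.2 x - g x <= q.2].
pose h (v : X * dual X) := f v.1 + fstar (- v.2).
have BC x g : B x g -> C (x, g, g x).
  move=> Bx y k By /=; have := Bmono _ _ _ _ Bx By.
  have -> : (g - k) (x - y) = g (x - y) - k (x - y) by [].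
  by rewrite !linearB /=; lra.
have CE u g r : C (u, g, r) -> g u <= r.
  (* If [r < g u], then [(u, g)] is monotonically related to the whole graph, so it belongs to it by
     maximality; membership in [C], tested at [(u, g)] itself, then gives [g u <= r]. *)
  move=> Cu; rewrite leNgt; apply/negP => rgu.
  suff /Cu : B u g by move=> /=; lra.
  apply: Bmax => x k /Cu /=.
  suff : k u + g x - k x <= r -> 0 <= k (x - u) - g (x - u) by [].
  by rewrite !linearB /=; lra.
have [||||L [Llin LC]] := @convex_separation R (X * dual X)%type C h.
- by exists (x0, g0, g0 x0); exact: BC.
- move=> t [u g] [v k] r s /andP[t0 t1] Cu Cv x p Bx /=.
  suff : p (t *: u + (1 - t) *: v) + (t * g x + (1 - t) * k x) - p x
      <= t * r + (1 - t) * s by [].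
  have := Cu _ _ Bx; have := Cv _ _ Bx => /= cv cu.
  rewrite linearD /= !dual_funZ.
  have := ler_wpM2l t0 cu; rewrite -subr_ge0 in t1.
  have := ler_wpM2l t1 cv; lra.
- move=> t [u g] [v k] t01; rewrite /h /=.
  have := bregman_convex bregman_gt0 u v t01.
  have := conjugate_convex (- g) (- k) t01.
  by rewrite opprD -!scalerN; lra.
- move=> u r Cu; have := CE u.1 u.2 r; rewrite -surjective_pairing => /(_ Cu).
  have := fenchel_young u.1 (- u.2); rewrite /h.
  have -> : (- u.2) u.1 = - u.2 u.1 by [].
  by lra.
have C0 := BC _ _ Bx0; set r0 := g0 x0 in C0; set l0 := L (x0, g0).
have LD a b : L (a + b) = L a + L b by have := Llin 1 a b; rewrite !scale1r.
have LZ t a : L (t *: a) = t * L a.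
  have L00 : L 0 = 0 by have := LD 0 0; rewrite addr0; lra.
  by have := Llin t a 0; rewrite !addr0 L00 addr0.
have LN x g : L (- x, - g) = - L (x, g).
  by have := LZ (- 1) (x, g); rewrite scaleN1r mulN1r.
(* Separation from the single point [(x0, g0, r0)] of [C] bounds each of the two partial functionals
   of [L] on the unit ball, through the upper bounds on [f] and [fstar] there. *)
have [||p pE] := @bounded_above_linear_dual _ _ (fun x => L (x, 0))
  (r0 + Mf + fstar 0 - l0).
- move=> t x y; have := LD (t *: (x, 0)) (y, 0); rewrite LZ => <-.
  by congr L; congr pair; rewrite /= scaler0 addr0.
- move=> x x1; have := LC _ _ (- x, - 0) C0; rewrite LN /h /= !opprK -/l0.
  by have := fM (- x); rewrite normrN => /(_ x1); lra.
have [||phi phiE] := @bounded_above_linear_dual _ _ (fun g : dual X => L (0, g))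
  (r0 + f 0 + Ms - l0).
- move=> t g k; have := LD (t *: (0, g)) (0, k); rewrite LZ => <-.
  by congr L; congr pair; rewrite /= scaler0 addr0.
- move=> g g1; have := LC _ _ (- 0, - g) C0; rewrite LN /h /= !opprK oppr0 -/l0.
  by have := sM g g1; lra.
have [z zE] := refl phi.
have LE x g : L (x, g) = p x + g z.
  have -> : (x, g) = (x, 0) + (0, g) by congr pair; rewrite /= ?addr0 ?add0r.
  by rewrite LD -pE -phiE -zE.
(* At the second component [- grad f z] the value of [fstar] is known and cancels down to [- f z];
   the supremum over [v] then produces [fstar (- p)]. *)
have star u g r : C (u, g, r) -> fstar (- p) <= r - p u - g z - f z.
  move=> Cu; apply: conjugate_le => v.
  have : p u + g z - (p v - grad f z z) <= r + (f v + fstar (grad f z)).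
    by have := LC _ _ (v, - grad f z) Cu; rewrite !LE /h /= opprK.
  suff : p u + g z - (p v - grad f z z) <= r + (f v + fstar (grad f z)) ->
    - p v - f v <= r - p u - g z - f z by [].
  by have := conjugate_grad_le z; lra.
have Bzp : B z p.
  apply: Bmax => x g /BC/star.
  have := fenchel_young z (- p); have -> : (- p) z = - p z by [].
  move=> H1 H2; suff : 0 <= g (x - z) - p (x - z) by [].
  by rewrite !linearB /=; lra.
(* Now [(z, p)] is in the graph, and [star] at this very point is the equality case of Fenchel-Young
   for [z] and [- p]. *)
exists z; suff -> : grad f z = - p by rewrite opprK.
apply: fenchel_eq_grad => //; have := star _ _ _ (BC _ _ Bzp).
by have -> : (- p) z = - p z by []; lra.
Qed.

End Conjugate.

(** * Convex sets and Bregman projections *)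

Lemma convex_setP (R : realType) (V : lmodType R) (A : set V) :
  convex_set A <-> forall (t : R) (x y : V), 0 <= t <= 1 -> A x -> A y ->
    A (t *: x + (1 - t) *: y).
Proof.
split=> [Aconv t x y /andP[t0 t1] Ax Ay|Aconv x y t].
  have := Aconv x y (Itv01 t0 t1); rewrite !inE => /(_ Ax Ay).
  by [].
rewrite !inE => Ax Ay; apply: Aconv => //.
by rewrite ge0 le1.
Qed.

Section BregmanProjection.
Context {R : realType} {X : completeNormedModType R} (f : X -> R^o)
  (f_diff : forall x, differentiable f x)
  (f_tc : totally_convex_on_bounded f).
Let gt0 := totally_convex_bregman_gt0 f_tc.

(** Follows from [bregman_combination], since D_f(-, x) differs from [f] by an affine function. *)
Lemma bregman_dist_combination (t : R) x y z :
  let m := t *: y + (1 - t) *: z in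
  t * bregman_dist f y x + (1 - t) * bregman_dist f z x = bregman_dist f m x +
    t * bregman_dist f y m + (1 - t) * bregman_dist f z m.
Proof.
move=> m; rewrite {1 2 3}/bregman_dist.
have -> : grad f x (m - x) = t * grad f x (y - x) + (1 - t) * grad f x (z - x).
  by rewrite !linearB /m linearD /= !dual_funZ; ring.
by have := bregman_combination f t y z; rewrite /= -/m; lra.
Qed.

(* D_f(-, x) is convex and vanishes at x, so it grows at least linearly along
   rays from x. *)
Lemma bregman_dist_ray x y (t d : R) : 0 < t <= `|y - x| ->
  (forall z, `|z - x| = t -> d <= bregman_dist f z x) ->
  d * `|y - x| <= t * bregman_dist f y x.
Proof.
move=> /andP[t0 tyx] dle; have yx0 := lt_le_trans t0 tyx.
rewrite -ler_pdivlMr // mulrAC; set s := t / _.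
have s0 : 0 <= s by rewrite divr_ge0 ?ltW.
have s1 : 0 <= 1 - s by rewrite subr_ge0 ler_pdivrMr // mul1r.
have := dle (s *: y + (1 - s) *: x);
  rewrite -segmentE addrK normrZ ger0_norm //.
rewrite divfK ?gt_eqF // segmentE => /(_ erefl)/le_trans; apply.
have := bregman_dist_combination s x y x;
  rewrite /= bregman_dist_refl mulr0 addr0 => ->.
by rewrite -addrA lerDl addr_ge0 // mulr_ge0 ?(bregman_ge0 gt0).
Qed.

Lemma continuous_bregman_dist x : continuous (bregman_dist f ^~ x : X -> R^o).
Proof.
move=> z; apply: cvgB; last first.
  apply: (@continuous_comp _ _ _ (fun z => z - x) (grad f x)).
    by apply: cvgB; [exact: cvg_id|exact: cvg_cst].
  exact: dual_continuous.
by apply: cvgB; [exact: differentiable_continuous|exact: cvg_cst].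
Qed.

Lemma bregman_minimizer (C : set X) x : C !=set0 -> closed C -> convex_set C ->
  exists2 p, C p & forall z, C z -> bregman_dist f p x <= bregman_dist f z x.
Proof.
move=> C0 Cclosed /convex_setP Cconv.
pose phi z := bregman_dist f z x; pose m := inf (phi @` C).
have phiinf : has_inf (phi @` C).
  split; first by have [z Cz] := C0; exists (phi z), z.
  by exists 0 => _ [z _ <-]; exact: bregman_ge0.
have mle z : C z -> m <= phi z.
  by move=> Cz; apply: ge_inf; [exact: phiinf.2|exists z].
pose S e := [set z | C z /\ phi z < m + e].
have S0 e : 0 < e -> S e !=set0.
  by move=> /inf_adherent/(_ phiinf)[_ [z Cz <-] ze]; exists z.
(* The filter of almost minimizers replaces a minimizing sequence. *)
pose F := filter_from [set e : R | 0 < e] S.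
have FF : ProperFilter F.
  apply: filter_from_proper; last exact: S0.
  apply: filter_from_filter; first by exists 1 => /=.
  move=> e e' /= e0 e'0; exists (Num.min e e'); first by rewrite /= lt_min e0.
  move=> z [Cz]; rewrite -ltrBlDl lt_min => /andP[ze ze'].
  by split; split; rewrite // -ltrBlDl.
have xb : bounded_set [set x].
  by exists `|x|; split=> [|M /ltW xM _ /= ->]; first exact: num_real.
have [d d0 dle] := totally_convex_lower_bound f_tc xb ltr01.
(* Beyond distance 1 from [x] the distance D_f(-, x) grows with slope at least [d], which confines
   the points of [S 1] to radius [(m + 1) / d]; the summand 1 covers the nearby points. *)
pose r := 1 + (m + 1) / d.
have m0 : 0 <= m by apply: lb_le_inf => [|_ [z _ <-]];
  [exact: phiinf.1|exact: bregman_ge0].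
have Sr z : S 1 z -> `|z - x| <= r.
  move=> [Cz zm]; have [z1|/ltW z1] := leP 1 `|z - x|; last first.
    by rewrite (le_trans z1) // lerDl divr_ge0 ?addr_ge0 // ltW.
  have := bregman_dist_ray (t := 1) (d := d); rewrite ltr01 => /(_ x z z1).
  rewrite mul1r => /(_ (fun y => dle x y erefl)) dz.
  rewrite /r -lerBlDl ler_pdivlMr // mulrBl mul1r [_ * d]mulrC.
  by move: dz zm; rewrite /phi; lra.
pose E := [set z | `|z - x| <= r].
have Eb : bounded_set E.
  exists (r + `|x|); split=> [|M /ltW rM z /= Ez]; first exact: num_real.
  apply: le_trans rM; rewrite -[z](subrK x); apply: le_trans (ler_normD _ _) _.
  by rewrite lerD2r.
have Fcauchy : cauchy F.
  apply: cauchy_exP => e e0.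
  have e20 : 0 < e / 2 by rewrite divr_gt0.
  have [k k0 kle] := totally_convex_lower_bound f_tc Eb e20.
  (* The bound 1 keeps almost minimizers and their midpoints in [E], where [k] is uniform. The bound
     [k / 2] forces [bregman_dist f z w < k]: half of this distance is at most the mean of [phi z]
     and [phi y] minus [phi w], hence below [c]. *)
  pose c := Num.min 1 (k / 2).
  have c0 : 0 < c by rewrite lt_min ltr01 divr_gt0.
  have Sc z : S c z -> S 1 z.
    by move=> [Cz zc]; split=> //; apply: lt_le_trans zc _;
      rewrite lerD2l ge_min lexx.
  have [z Sz] := S0 c c0; exists z; exists c => // y Sy.
  rewrite -ball_normE /ball_ /=.
  pose w := 2^-1 *: z + (1 - 2^-1) *: y.
  have half01 : 0 <= (2^-1 : R) <= 1 by apply/andP; split; lra.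
  have Cw : C w by apply: Cconv; [|exact: Sz.1|exact: Sy.1].
  have zw : z - w = 2^-1 *: (z - y).
    rewrite /w -segmentE opprD addrCA addrC -{1}[z - y]scale1r -scalerBl.
    by congr (_ *: _); lra.
  have Ew : E w.
    have wx : w - x = 2^-1 *: (z - x) + (1 - 2^-1) *: (y - x).
      by rewrite !scalerBr addrACA -opprD -scalerDl [2^-1 + _]addrC subrK
        scale1r.
    rewrite /E /= wx; apply: le_trans (ler_normD _ _) _; rewrite !normrZ.
    have /andP[h0 h1] := half01; rewrite !ger0_norm ?subr_ge0 //.
    have := ler_wpM2l h0 (Sr z (Sc z Sz)); rewrite -subr_ge0 in h1.
    by have := ler_wpM2l h1 (Sr y (Sc y Sy)); lra.
  have : bregman_dist f z w < k.
    have := bregman_dist_combination 2^-1 x z y; rewrite /= -/w.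
    have := bregman_ge0 gt0 w y; have := mle w Cw.
    have := Sz.2; have := Sy.2; rewrite /phi.
    have : c <= k / 2 by rewrite ge_min lexx orbT.
    by lra.
  (* Here [z - w] is half of [z - y]. If its norm were at least [e / 2], growth along the ray from
     [w] would make [bregman_dist f z w] at least [k]. *)
  have [zwe|] := leP (e / 2) `|z - w|; last first.
    rewrite zw normrZ ger0_norm ?invr_ge0 // [_ / 2]mulrC => + _.
    by rewrite ltr_pM2l // invr_gt0.
  have := bregman_dist_ray (t := e / 2) (d := k); rewrite e20 => /(_ w z zwe).
  move=> /(_ (fun y => kle w y Ew)) kzw zwk; exfalso.
  move: zwk; rewrite -(ltr_pM2l e20); have := ler_wpM2l (ltW k0) zwe.
  by lra.
have Fp : cvg F by exact: cauchy_cvg.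
set p := lim F in Fp.
have Cp : C p.
  apply: (@closed_cvg X X F _ id C Cclosed); last exact: Fp.
  by exists 1 => //= z [].
exists p => // z Cz; apply: le_trans (mle z Cz).
apply/ler_addgt0Pr => e e0.
have phip : phi y @[y --> F] --> phi p.
  apply: (@cvg_comp _ _ _ id phi F (nbhs p)) => //.
  exact: continuous_bregman_dist.
apply: (cvgr_to_le phip); exists e => // y [_ /ltW].
by [].
Qed.

(** The midpoint of two distinct minimizers would have a strictly smaller distance to [x]. *)
Lemma bregman_proj_exists (C : set X) x :
  C !=set0 -> closed C -> convex_set C -> exists p, is_bregman_proj f C x p.
Proof.
move=> C0 Cclosed Cconv.
have [p Cp pmin] := bregman_minimizer x C0 Cclosed Cconv.
exists p; apply/seteqP; split=> [q [Cq qmin] /=|_ ->//].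
apply/eqP/negPn/negP => qp.
have half01 : 0 <= (2^-1 : R) <= 1 by apply/andP; split; lra.
pose w := 2^-1 *: q + (1 - 2^-1) *: p.
have Cw : C w by move/convex_setP : Cconv; apply.
have qw : q != w.
  rewrite -subr_eq0 /w -segmentE opprD addrCA addrC -{1}[q - p]scale1r
    -scalerBl.
  by rewrite scaler_eq0 negb_or [q - p == 0]subr_eq0 qp andbT; lra.
have := bregman_dist_combination 2^-1 x q p; rewrite /= -/w.
have := pmin _ Cw; have := qmin _ Cw; have := gt0 qw.
by have := bregman_ge0 gt0 w p; lra.
Qed.

(** First-order optimality at [p] along the segment towards [z]. *)
Lemma bregman_proj_variational (C : set X) x p z : convex_set C ->
  is_bregman_proj f C x p -> C z -> (grad f x - grad f p) (z - p) <= 0.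
Proof.
move=> /convex_setP Cconv Cp Cz.
have [{}Cp pmin] : [set q | C q /\ forall z, C z ->
  bregman_dist f q x <= bregman_dist f z x] p by rewrite Cp.
suff : grad f x (z - p) - grad f p (z - p) <= 0 by [].
rewrite subr_le0; apply: le_grad => // t /andP[t0 t1].
have := pmin (t *: (z - p) + p); rewrite segmentE => /(_ _)/wrap[].
  by apply: Cconv => //; rewrite ltW.
rewrite -segmentE /bregman_dist.
have -> : grad f x (t *: (z - p) + p - x) =
    t * grad f x (z - p) + grad f x (p - x).
  by rewrite -addrA linearD /= dual_funZ.
by lra.
Qed.

End BregmanProjection.

(** * Half-spaces and intersections of convex sets *)

Section HalfSpace.
Context {R : realType} {X : normedModType R}.

Lemma closed_half_space (g : dual X) (c : R) : closed [set z | g z <= c].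
Proof.
apply: (@preimage_closed _ _ g [set r : R^o | r <= c]); last exact: closed_le.
by move=> x _; exact: dual_continuous.
Qed.

Lemma convex_half_space (g : dual X) (c : R) : convex_set [set z | g z <= c].
Proof.
apply/convex_setP => t x y /andP[t0 t1] /= gx gy.
rewrite linearD /= !dual_funZ; rewrite -subr_ge0 in t1.
by have := ler_wpM2l t0 gx; have := ler_wpM2l t1 gy; lra.
Qed.

Lemma convex_setI (A B : set X) :
  convex_set A -> convex_set B -> convex_set (A `&` B).
Proof.
move=> /convex_setP Ac /convex_setP Bc; apply/convex_setP => t x y t01.
by move=> [Ax Bx] [Ay By]; split; [exact: Ac|exact: Bc].
Qed.

Lemma convex_bigcap I (D : set I) (A : I -> set X) :
  (forall i, D i -> convex_set (A i)) -> convex_set (\bigcap_(i in D) A i).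
Proof.
move=> Ac; apply/convex_setP => t x y t01 Ax Ay i Di.
by have /convex_setP := Ac i Di; apply=> //; [exact: Ax|exact: Ay].
Qed.

(** The terms [f z] on both sides cancel, leaving an affine inequality in [z]. *)
Lemma bregman_half_spaceE (f : X -> R^o) y w :
  [set z | bregman_dist f z y <= bregman_dist f z w] =
  [set z | (grad f w - grad f y) z <=
    f y - grad f y y - (f w - grad f w w)].
Proof.
apply/funext => z; apply/propext => /=.
suff : (bregman_dist f z y <= bregman_dist f z w) <->
  (grad f w z - grad f y z <= f y - grad f y y - (f w - grad f w w)) by [].
by rewrite /bregman_dist !linearB /=; split; lra.
Qed.

Lemma half_space_centerE (g : dual X) x :
  [set z | g (z - x) <= 0] = [set z | g z <= g x].
Proof. by apply/funext => z; rewrite /= linearB /= subr_le0. Qed.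

End HalfSpace.

(** * Resolvents of maximally monotone operators *)

Section MaximallyMonotone.
Context {R : realType} {X : normedModType R}.

(** Otherwise adjoining [(z, p)] to the graph gives a proper monotone extension. *)
Lemma maximally_monotoneP (A : X -> set (dual X)) : maximally_monotone A ->
  forall z p, (forall x g, A x g -> 0 <= (g - p) (x - z)) -> A z p.
Proof.
move=> [Amono Amax] z p zp; apply: contrapT => nA; apply: Amax.
exists (fun x => A x `|` [set g | x = z /\ g = p]); split.
  move=> x y g h [Ax|[-> ->]] [Ay|[-> ->]].
  - exact: Amono.
  - exact: zp.
  - suff : 0 <= p (z - y) - h (z - y) by [].
    have : 0 <= h (y - z) - p (y - z) by exact: zp Ay.
    by rewrite !linearB /=; lra.
  - by suff : 0 <= p (z - z) - p (z - z) by []; rewrite subrr.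
split=> [[x g] Ax /=|/(_ (z, p)) /= AB]; first by left.
by apply: nA; apply: AB; right.
Qed.

End MaximallyMonotone.

Section Resolvent.
Context {R : realType} {X : completeNormedModType R} (f : X -> R^o)
  (refl : reflexive_space X)
  (f_diff : forall x, differentiable f x)
  (bregman_gt0 : forall x y, y != x -> 0 < bregman_dist f y x)
  (fstar_fin : forall g, conjugate f g \is a fin_num)
  (f_ub : exists M, forall x, `|x| <= 1 -> f x <= M)
  (fstar_ub : exists M, forall g : dual X, `|g| <= 1 -> conjugate_fun f g <= M).

Local Notation resolvent A l w :=
  (op_inv (op_add (op_scale l A) (op_of_fun (grad f))) w).

Lemma resolventP (A : X -> set (dual X)) (l : R) w y :
  resolvent A l w y <-> exists2 a, A y a & l *: a + grad f y = w.
Proof.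
split=> [[_ [a Aya <-]] [_ -> <-]|[a Aya <-]]; first by exists a.
by exists (l *: a); [exists a|exists (grad f y)].
Qed.

Lemma resolvent_singleton (A : X -> set (dual X)) (l : R) w :
  maximally_monotone A -> (exists x g, A x g) -> 0 < l ->
  exists y, resolvent A l w = [set y].
Proof.
move=> Amax [x0 [g0 Ax0]] l0.
have [|||y [a Aya ya]] := maximal_monotone_grad_surjective bregman_gt0
    fstar_fin (B := fun x => [set l *: a - w | a in A x]) refl f_diff f_ub
      fstar_ub.
- by exists x0, (l *: g0 - w), g0.
- move=> x y _ _ [a Axa <-] [b Ayb <-].
  suff : 0 <= l * a (x - y) - w (x - y) - (l * b (x - y) - w (x - y)) by [].
  have : 0 <= a (x - y) - b (x - y) by exact: Amax.1 Axa Ayb.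
  by move/(ler_wpM2l (ltW l0)); lra.
(* The map [a |-> l *: a - w] carries the graph of [A] to that of the shifted operator; this is the
   preimage of [p]. *)
- move=> z p zp; exists (l^-1 *: (p + w)); last first.
    by rewrite scalerA mulfV ?gt_eqF // scale1r addrK.
  apply: (maximally_monotoneP Amax) => x a Axa.
  suff : 0 <= a (x - z) - l^-1 * (p (x - z) + w (x - z)) by [].
  have : 0 <= l * a (x - z) - w (x - z) - p (x - z).
    exact: (zp x (l *: a - w) (ex_intro2 _ _ a Axa erefl)).
  rewrite -(pmulr_rge0 (a _ - _) l0) mulrBr mulrA mulfV ?gt_eqF // mul1r.
  by lra.
exists y; apply/seteqP; split=> [z /resolventP[b Azb zb]|_ ->]; last first.
  by apply/resolventP; exists a => //;
    rewrite -(opprK (grad f y)) -ya opprB addrC subrK.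
apply/eqP/negPn/negP => zy.
(* Here [grad f z - grad f y = - l *: (b - a)], and monotonicity of [A] makes its pairing with
   [z - y] nonpositive. *)
have := grad_strictly_monotone bregman_gt0 zy.
suff : 0 < grad f z (z - y) - grad f y (z - y) -> False by [].
have : 0 <= b (z - y) - a (z - y) by exact: Amax.1 Azb Aya.
move/(ler_wpM2l (ltW l0)).
have -> : grad f z = w - l *: b by rewrite -zb addrAC subrr add0r.
have -> : grad f y = w - l *: a by rewrite -opprB ya opprK.
suff : l * 0 <= l * (b (z - y) - a (z - y)) ->
  0 < w (z - y) - l * b (z - y) - (w (z - y) - l * a (z - y)) -> False by [].
by lra.
Qed.

Lemma le_bregman_dist_resolvent (A : X -> set (dual X)) (l : R) y w z xi :
  monotone_op A -> A z 0 -> A y xi -> 0 < l ->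
  grad f w = l *: xi + grad f y ->
  bregman_dist f z y <= bregman_dist f z w.
Proof.
move=> Amono Az Ay l0 wE.
have : 0 <= xi (y - z) - 0 by exact: Amono Ay Az.
move/(ler_wpM2l (ltW l0)).
have := bregman_ge0 bregman_gt0 w y.
have wyE u : grad f w u = l * xi u + grad f y u by rewrite wE.
by rewrite /bregman_dist !wyE !linearB /=; lra.
Qed.

End Resolvent.

(** With [a = grad f y] and [b = grad f x] this passes from the first equation of the system to the
    resolvent inclusion. *)
Lemma resolvent_equationP (R : numFieldType) (V : lmodType R) (l : R)
    (e xi a b : V) : 0 < l ->
  e = xi + (1 / l) *: (a - b) <-> l *: xi + a = l *: e + b.
Proof.
move=> /gt_eqF l0; rewrite div1r; split=> [->|eE].
  by rewrite scalerDr scalerA mulfV ?l0 // scale1r -addrA subrK.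
apply: (@scalerI _ _ l); first by rewrite l0.
by rewrite scalerDr scalerA mulfV ?l0 // scale1r addrA eE addrK.
Qed.

(** * Construction and uniqueness of the iteration *)

Section Iteration.
Context {R : realType} {X : completeNormedModType R} {N : nat}
  (A : 'I_N -> X -> set (dual X)) (f : X -> R^o)
  (refl : reflexive_space X)
  (A_maxmon : forall i, maximally_monotone (A i))
  (Z_nonempty : common_zeros A !=set0)
  (f_diff : forall x, differentiable f x)
  (f_tc : totally_convex_on_bounded f)
  (fstar_fin : forall g, conjugate f g \is a fin_num)
  (fstar_diff : forall g, differentiable (conjugate_fun f) g)
  (f_ub : exists M, forall x, `|x| <= 1 -> f x <= M)
  (fstar_ub : exists M, forall g : dual X, `|g| <= 1 -> conjugate_fun f g <= M)
  (x0 : X) (eta : nat -> 'I_N -> dual X) (lambda : nat -> 'I_N -> R)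
  (lambda_gt0 : forall n i, 0 < lambda n i).
Let gt0 := totally_convex_bregman_gt0 f_tc.

Definition resolvent n i x : set X :=
  op_inv (op_add (op_scale (lambda n i) (A i)) (op_of_fun (grad f)))
    (lambda n i *: eta n i + grad f x).

(** Carries existence, uniqueness and the explicit formulas for [y] and [xi] all at once. *)
Lemma iterate_resolventP n i x y xi :
  (eta n i = xi + (1 / lambda n i) *: (grad f y - grad f x) /\ A i y xi) <->
  (resolvent n i x y /\
   xi = eta n i - (1 / lambda n i) *: (grad f y - grad f x)).
Proof.
split=> [[etaE Ay]|[/resolventP[a Aa aE] ->]].
  split; last by rewrite etaE addrK.
  by apply/resolventP; exists xi => //; apply/resolvent_equationP.
split; first by rewrite subrK.
by rewrite ((resolvent_equationP _ _ _ _ (lambda_gt0 n i)).2 aE) addrK.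
Qed.

Lemma iterate_resolvent_singleton n i x : exists y, resolvent n i x = [set y].
Proof.
apply: resolvent_singleton => //.
by have [z Zz] := Z_nonempty; exists z, 0; exact: Zz.
Qed.

(** The centres are arbitrary, so that this serves both while the next iterate is being constructed
    and for the finished sequence. *)
Lemma bregman_cut_closed_convex (y w : 'I_N -> X) (g : dual X) x :
  let K := \bigcap_(i in [set: 'I_N])
    [set z | bregman_dist f z (y i) <= bregman_dist f z (w i)] `&`
    [set z | g (z - x) <= 0] in
  closed K /\ convex_set K.
Proof.
split.
  apply: closedI; last by rewrite half_space_centerE; exact: closed_half_space.
  apply: closed_bigI => i _; rewrite bregman_half_spaceE.
  exact: closed_half_space.
apply: convex_setI; last by rewrite half_space_centerE;
  exact: convex_half_space.
apply: convex_bigcap => i _; rewrite bregman_half_spaceE.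
exact: convex_half_space.
Qed.

(** This and the following components depend on the current point [x] only, which reduces the system
    to a recursion for [x]. *)
Definition iterate_y n i x := xget 0 (resolvent n i x).

Definition iterate_w n i x :=
  grad_conjugate f (lambda n i *: eta n i + grad f x).

Definition iterate_Ci n i x := [set z |
  bregman_dist f z (iterate_y n i x) <= bregman_dist f z (iterate_w n i x)].

Definition iterate_C n x := \bigcap_(i in [set: 'I_N]) iterate_Ci n i x.

Definition iterate_Q x := [set z | (grad f x0 - grad f x) (z - x) <= 0].

(** The default 0 would be taken if there were no projection; [common_zeros_sub_Q] excludes this
    along the iteration. *)
Definition iterate_next n x : X :=
  xget 0 [set p | is_bregman_proj f (iterate_C n x `&` iterate_Q x) x0 p].

Definition iterate_x : nat -> X := nat_rect (fun=> X) x0 iterate_next.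

Definition iterate : iterates X N := {|
  it_w n i := iterate_w n i (iterate_x n) ;
  it_y n i := iterate_y n i (iterate_x n) ;
  it_xi n i := eta n i - (1 / lambda n i) *:
    (grad f (iterate_y n i (iterate_x n)) - grad f (iterate_x n)) ;
  it_Ci n i := iterate_Ci n i (iterate_x n) ;
  it_C n := iterate_C n (iterate_x n) ;
  it_Q n := iterate_Q (iterate_x n) ;
  it_x := iterate_x |}.

Lemma resolvent_iterate_y n i x : resolvent n i x = [set iterate_y n i x].
Proof.
have [y yE] := iterate_resolvent_singleton n i x.
rewrite /iterate_y yE; congr set1; apply/esym.
by apply: (@xgetPex _ 0 [set y]); exists y.
Qed.

(** By [grad_grad_conjugate], [grad f w] equals [l *: xi + grad f y], so [le_bregman_dist_resolvent]
    applies at each common zero. *)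
Lemma common_zeros_sub_C n x : common_zeros A `<=` iterate_C n x.
Proof.
move=> z Zz i _.
have [] : resolvent n i x (iterate_y n i x) by rewrite resolvent_iterate_y.
move=> _ [xi Axi <-] [_ -> yE]; apply: (le_bregman_dist_resolvent gt0
  (A_maxmon i).1 (Zz i I) Axi (lambda_gt0 n i)).
by rewrite yE; exact: grad_grad_conjugate.
Qed.

(** A joint induction: a common zero in the n-th cut makes it nonempty, so the next iterate is a
    genuine projection, and its variational inequality is the inclusion for the next [iterate_Q]. *)
Lemma common_zeros_sub_Q n : common_zeros A `<=` iterate_Q (iterate_x n) /\
  is_bregman_proj f (iterate_C n (iterate_x n) `&` iterate_Q (iterate_x n)) x0
    (iterate_x n.+1).
Proof.
have proj m : common_zeros A `<=` iterate_Q (iterate_x m) ->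
    is_bregman_proj f (iterate_C m (iterate_x m) `&` iterate_Q (iterate_x m)) x0
    (iterate_x m.+1).
  move=> ZQ; have [Kclosed Kconvex] := bregman_cut_closed_convex
    (iterate_y m ^~ (iterate_x m)) (iterate_w m ^~ (iterate_x m))
    (grad f x0 - grad f (iterate_x m)) (iterate_x m).
  apply: xgetPex; apply: bregman_proj_exists => //.
  by have [z Zz] := Z_nonempty; exists z; split;
    [exact: common_zeros_sub_C|exact: ZQ].
suff ZQ : common_zeros A `<=` iterate_Q (iterate_x n) by split=> //;
  exact: proj.
elim: n => [|n IHn] z Zz.
  (* At [n = 0] the functional defining [iterate_Q] is zero. *)
  by suff : grad f x0 (z - x0) - grad f x0 (z - x0) <= 0 by []; rewrite subrr.
apply: (bregman_proj_variational f_diff _ (proj n IHn)).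
  exact: (bregman_cut_closed_convex _ _ _ _).2.
by split; [exact: common_zeros_sub_C|exact: IHn].
Qed.

Lemma iterateP : bregman_system A f x0 eta lambda iterate.
Proof.
have res n i : resolvent n i (iterate_x n) (iterate_y n i (iterate_x n)).
  by rewrite resolvent_iterate_y.
have yP n i := (iterate_resolventP _ _ _ _ _).2 (conj (res n i) erefl).
split=> //=.
- by move=> n i; exact: (yP n i).1.
- by move=> n i; exact: (yP n i).2.
- by move=> n; exact: (common_zeros_sub_Q n).2.
Qed.

(** The current point determines every other component at step [n], so induction on the points [x n]
    suffices. *)
Lemma bregman_system_unique s : bregman_system A f x0 eta lambda s ->
  iterate = s.
Proof.
case: s => w y xi Ci C Q x [/= x0E etaE xiE wE CiE CE QE projE].
have yxi n i := (iterate_resolventP _ _ _ _ _).1 (conj (etaE n i) (xiE n i)).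
have yE n i : y n i = iterate_y n i (x n).
  by have [+ _] := yxi n i; rewrite resolvent_iterate_y.
have CE' n : C n = iterate_C n (x n).
  rewrite CE; apply: eq_bigcapr => i _.
  by rewrite CiE yE wE.
have xE n : x n = iterate_x n.
  elim: n => [//|n IHn]; have := projE n; rewrite CE' QE IHn.
  (* Both candidates are given by the same set of minimizers, so their singletons coincide. *)
  have := (common_zeros_sub_Q n).2; rewrite /is_bregman_proj => -> /seteqP[+ _].
  by move/(_ (iterate_x n.+1) erefl) => ->.
have xE' : x = iterate_x by apply/funext.
rewrite xE' in yxi yE wE CiE CE' QE *; rewrite /iterate; congr Iterates.
- by apply/funext => n; apply/funext => i; rewrite wE.
- by apply/funext => n; apply/funext => i; rewrite yE.
- by apply/funext => n; apply/funext => i; rewrite -yE (yxi n i).2.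
- by apply/funext => n; apply/funext => i; rewrite CiE yE wE.
- by apply/funext => n; rewrite CE'.
- by apply/funext => n; rewrite QE.
Qed.

End Iteration.

Theorem theorem8p1 (R : realType) (X : completeNormedModType R)
  (X_reflexive : reflexive_space X)
  (N : nat) (A : 'I_N -> X -> set (dual X))
  (A_maxmon : forall i, maximally_monotone (A i))
  (Z_nonempty : common_zeros A !=set0)
  (f : X -> R^o)
  (f_bounded : forall E : set X, E !=set0 -> convex_set E -> bounded_set E ->
    [bounded f x | x in E])
  (f_frechet : forall E : set X, E !=set0 -> convex_set E -> bounded_set E ->
    uniformly_frechet_on f E)
  (f_totconvex : totally_convex_on_bounded f)
  (fstar_bounded : forall E : set (dual X), bounded_set E ->
    exists M : R, forall g, E g -> (`|conjugate f g| <= M%:E)%E)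
  (fstar_frechet : forall E : set (dual X), bounded_set E ->
    uniformly_frechet_on (conjugate_fun f) E)
  (x0 : X) (eta : nat -> 'I_N -> dual X) (lambda : nat -> 'I_N -> R)
  (lambda_gt0 : forall n i, 0 < lambda n i) :
  (exists! s : iterates X N, bregman_system A f x0 eta lambda s) /\
  (forall s : iterates X N, bregman_system A f x0 eta lambda s ->
    (forall n i,
      op_inv (op_add (op_scale (lambda n i) (A i)) (op_of_fun (grad f)))
        (lambda n i *: eta n i + grad f (it_x s n)) = [set it_y s n i] /\
      it_xi s n i = eta n i -
        (1 / lambda n i) *: (grad f (it_y s n i) - grad f (it_x s n))) /\
    (forall n,
      [/\ convex_set (it_C s n `&` it_Q s n),
          closed (it_C s n `&` it_Q s n) &
          common_zeros A `<=` it_C s n `&` it_Q s n])).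
Proof.
(* Singletons turn the hypotheses on bounded sets into pointwise differentiability and finiteness of
   the conjugate; the unit ball provides the upper bounds [f_ub] and [fstar_ub]. *)
have f_diff x : differentiable f x.
  have xb : bounded_set [set x].
    by exists `|x|; split=> [|M /ltW xM _ /= ->]; first exact: num_real.
  have xc : convex_set [set x].
    apply/convex_setP => t y z _ -> ->.
    by rewrite -scalerDl addrC subrK scale1r.
  by have [+ _] := f_frechet _ (ex_intro _ x erefl) xc xb; apply.
have gb (g : dual X) : bounded_set [set g].
  by exists `|g|; split=> [|M /ltW gM _ /= ->]; first exact: num_real.
have fstar_diff g : differentiable (conjugate_fun f) g.
  by have [+ _] := fstar_frechet _ (gb g); apply.
have fstar_fin g : conjugate f g \is a fin_num.
  have [M /(_ g erefl)] := fstar_bounded _ (gb g).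
  by case: (conjugate f g).
have ball_bounded (V : normedModType R) : bounded_set [set x : V | `|x| <= 1].
  by exists 1; split=> // M /ltW M1 x /= /le_trans; exact.
have f_ub : exists M, forall x, `|x| <= 1 -> f x <= M.
  have [| |M [_ fM]] := f_bounded [set x | `|x| <= 1] _ _ (ball_bounded X).
  - by exists 0; rewrite /= normr0.
  - apply/convex_setP => t x y /andP[t0 t1] /= x1 y1.
    apply: le_trans (ler_normD _ _) _; rewrite -subr_ge0 in t1.
    rewrite !normrZ !ger0_norm //.
    by have := ler_wpM2l t0 x1; have := ler_wpM2l t1 y1; lra.
  (* Boundedness gives every constant strictly above [M] as a bound. *)
  exists (M + 1) => x x1; apply: le_trans (ler_norm _) _.
  by apply: fM x1; rewrite ltrDl.
have fstar_ub : exists M, forall g : dual X, `|g| <= 1 ->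
    conjugate_fun f g <= M.
  have [M fM] := fstar_bounded _ (ball_bounded (dual X)).
  exists M => g /fM; rewrite -lee_fin fineK //; apply: le_trans.
  exact: lee_abs.
have sysP := iterateP X_reflexive A_maxmon Z_nonempty f_diff f_totconvex
  fstar_fin fstar_diff f_ub fstar_ub x0 eta lambda_gt0.
have sysU := bregman_system_unique X_reflexive A_maxmon Z_nonempty f_diff
  f_totconvex fstar_fin fstar_diff f_ub fstar_ub lambda_gt0.
split; first by exists (iterate A f x0 eta lambda); split=> // s; exact: sysU.
(* By uniqueness every solution is [iterate], for which the remaining claims are already
   established. *)
move=> s /sysU <-; split=> [n i|n]; first split=> //.
  exact: resolvent_iterate_y.
have [Kclosed Kconvex] := bregman_cut_closed_convex f
  (it_y (iterate A f x0 eta lambda) n) (it_w (iterate A f x0 eta lambda) n)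
  (grad f x0 - grad f (iterate_x A f x0 eta lambda n))
  (iterate_x A f x0 eta lambda n).
split=> // z Zz; split; first exact: common_zeros_sub_C.
have [+ _] := common_zeros_sub_Q X_reflexive A_maxmon Z_nonempty f_diff
  f_totconvex fstar_fin fstar_diff f_ub fstar_ub x0 eta lambda_gt0 n.
exact.
Qed.
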